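(* The set $\{0,1,2,3,4,5,6,7,8,9,10,11,12,13,14,15,16\}$ is extreme in $\mathbb Z_{18}$.
   Context: $\mathbb Z_n$ denotes the cyclic group of order $n$. For a finite abelian group $G$ with dual group $\Gamma$ and a complex measure $\mu$ on $G$: $\|\mu\|=\sum_{x\in G}|\mu(\{x\})|$, $\widehat\mu(\gamma)=\sum_{x\in G}\overline{\gamma(x)}\,\mu(\{x\})$ for $\gamma\in\Gamma$, and $\|\widehat\mu\|_\infty=\max_\gamma|\widehat\mu(\gamma)|$. A non-zero measure $\mu$ on $G$ is extreme if $\|\widehat\mu\|_\infty=\|\mu\|/\sqrt{\#\mathrm{supp}\,\mu}$. A set $E\subset G$ is extreme if it is the support of an extreme measure on $G$. *)

(* Defs.v *)
From mathcomp Require Import all_boot all_order all_algebra fingroup cyclic.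
From mathcomp Require Import all_classical all_reals.
From mathcomp Require Export complex.

Set Implicit Arguments.
Unset Strict Implicit.
Unset Printing Implicit Defensive.

Import Order.TTheory GRing.Theory Num.Theory.
Import ComplexField.Normc.

Local Open Scope classical_set_scope.
Local Open Scope ring_scope.
Local Open Scope complex_scope.

(* Complex numbers are [R[i]] for [R : realType], and [normc : R[i] -> R] is
   the modulus.  A complex measure [mu] on a finite abelian group [G] is
   represented by its values on points, [mu x] standing for mu({x}). *)

Definition is_character (R : realType) (G : finZmodType) (chi : G -> R[i]) :
    Prop :=
  (forall x, normc (chi x) = 1) /\ {morph chi : x y / x + y >-> x * y}.

Definition msupp (R : realType) (G : finZmodType) (mu : {ffun G -> R[i]}) :
    {set G} :=
  [set x | mu x != 0]%SET.

Definition mnorm (R : realType) (G : finZmodType) (mu : {ffun G -> R[i]}) : R :=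
  \sum_(x : G) normc (mu x).

Definition fourier (R : realType) (G : finZmodType) (mu : {ffun G -> R[i]})
    (chi : G -> R[i]) : R[i] :=
  \sum_(x : G) (chi x)^* * mu x.

(* The supremum is a maximum: see [fourier_normP]. *)
Definition fourier_norm (R : realType) (G : finZmodType)
    (mu : {ffun G -> R[i]}) : R :=
  sup [set normc (fourier mu chi) | chi in [set chi | is_character chi]].

Definition extreme_measure (R : realType) (G : finZmodType)
    (mu : {ffun G -> R[i]}) : Prop :=
  mu != 0 /\ fourier_norm mu = mnorm mu / Num.sqrt (#|msupp mu|%:R).

Definition extreme_set (R : realType) (G : finZmodType) (E : {set G}) : Prop :=
  exists mu : {ffun G -> R[i]}, extreme_measure mu /\ msupp mu = E.

Lemma is_character0 (R : realType) (G : finZmodType) (chi : G -> R[i]) :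
  is_character chi -> chi 0 = 1.
Proof.
move=> [chi1 chiD].
have nz : chi 0 != 0.
  by apply/eqP => c0; have := chi1 0; rewrite c0 normc0 => /esym/eqP; rewrite oner_eq0.
by apply: (mulfI nz); rewrite -chiD addr0 mulr1.
Qed.

Lemma is_character_mulrn (R : realType) (G : finZmodType) (chi : G -> R[i])
    (x : G) (n : nat) :
  is_character chi -> chi (x *+ n) = chi x ^+ n.
Proof.
move=> cchi; elim: n => [|n IHn]; first by rewrite mulr0n expr0 is_character0.
by rewrite mulrS exprS (proj2 cchi) IHn.
Qed.

Lemma fourier_normP (R : realType) (G : finZmodType) (mu : {ffun G -> R[i]}) :
  exists2 chi : G -> R[i], is_character chi &
    fourier_norm mu = normc (fourier mu chi) /\
    forall psi, is_character psi ->
      normc (fourier mu psi) <= normc (fourier mu chi).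
Proof.
have [n n_gt0 Gn] : exists2 n, (0 < n)%N & forall x : G, x *+ n = 0.
  exists #|[set: G]%SET|; first by apply/card_gt0P; exists 0; rewrite inE.
  by move=> x; apply: (@expg_cardG _ [set: G]%G x); rewrite inE.
have [s Ds] := closed_field_poly_normal ('X^n - 1 : {poly R[i]}).
have sP (chi : G -> R[i]) (x : G) : is_character chi -> chi x \in s.
  move=> cchi; have := monicXnsubC (1 : R[i]) n_gt0; rewrite polyC1 => /monicP lc1.
  rewrite -root_prod_XsubC -[X in root X _]scale1r -lc1 -Ds.
  by rewrite rootE hornerD hornerN hornerXn hornerC -(is_character_mulrn x n cchi) Gn (is_character0 cchi) subrr.
pose ch (f : {ffun G -> seq_sub s}) : G -> R[i] := fun x => val (f x).
have chP (psi : G -> R[i]) : is_character psi -> exists f, psi = ch f.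
  move=> cpsi; exists [ffun x => SeqSub (sP psi x cpsi)].
  by apply/funext => x; rewrite /ch ffunE.
have c1 : is_character ((fun=> 1) : G -> R[i]).
  by split=> [x|x y]; rewrite ?normc1 ?mulr1.
have [f0 Df0] := chP _ c1.
have P0 : `[< is_character (ch f0) >] by apply/asboolP; rewrite -Df0.
case: (@Order.TotalTheory.arg_maxP _ _ _ f0
  (fun f => `[< is_character (ch f) >]) (fun f => normc (fourier mu (ch f))) P0).
move=> f /asboolP cf fmax.
have le_f (psi : G -> R[i]) : is_character psi ->
    normc (fourier mu psi) <= normc (fourier mu (ch f)).
  by move=> cpsi; have [g Dg] := chP _ cpsi; rewrite Dg; apply/fmax/asboolP; rewrite -Dg.
exists (ch f) => //; split=> //.
apply/eqP; rewrite eq_le; apply/andP; split.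
  apply: ge_sup; first by exists (normc (fourier mu (ch f))); exists (ch f).
  by move=> _ [psi cpsi <-]; apply: le_f.
apply: ub_le_sup; last by exists (ch f).
by exists (normc (fourier mu (ch f))) => _ [psi cpsi <-]; apply: le_f.
Qed.

(* Main.v *)
Require Import Defs.
From mathcomp Require Import all_boot all_order all_algebra all_reals.
From mathcomp Require Import ring.

(** By the Cauchy-Schwarz inequality and the Parseval identity, a measure is
    extreme exactly when it has constant modulus on its support and its Fourier
    transform has constant modulus.  So the task is to find unimodular numbers
    at 0, ..., 16 and 0 at 17 whose transform on Z_18 has modulus sqrt 17
    everywhere.

    Such a sequence comes from the finite field with 17^2 elements.  Let theta
    be a generator of its multiplicative group, Tr the trace to F_17 and eta the
    quadratic character of F_17.  Since theta^18 generates the multiplicative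
    group of F_17, the sequence e_j = eta (Tr (theta^j)) satisfies
    e_(j + 18) = - e_j.  It vanishes once in every period and it is orthogonal
    to its first 17 shifts, because two linear forms Tr and Tr (theta^t _) that
    are not proportional over F_17 take each pair of values exactly once.
    Multiplying by powers of i, where i^18 = -1, makes the sequence 18-periodic
    and keeps the shifts orthogonal, which is the flatness of the transform.

    Once the signs are written down, only polynomial algebra remains.  The value
    of the transform at a character chi is the sign polynomial at
    u = conj (chi 1) i, a point of the unit circle with u^18 = -1
    ([fourier_mu18]).  Its squared modulus is the product of the sign polynomial
    at u and at u^-1, and that product is 17 as soon as u^18 = -1
    ([sgn18_sum_flat]). *)

Local Open Scope ring_scope.

Import GRing.Theory Num.Theory Order.TTheory ComplexField.Normc.
Local Open Scope complex_scope.

(** These are the values eta (Tr (theta^j)) between two consecutive zeros, for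
    theta = 3 + 2 sqrt 3 in F_17[sqrt 3] and j = 28, ..., 44.  The zero that
    follows, at index 17, is supplied as the default value of [nth]. *)
Definition sgn18 : seq int :=
  [:: 1; -1; -1; -1; -1; -1; 1; 1; 1; -1; 1; 1; -1; 1; -1; 1; 1].

Definition sgn18_sum {K : comNzRingType} (u : K) : K :=
  \sum_(k < 17) (sgn18`_k)%:~R * u ^+ k.

Lemma sgn18_sumE (K : comNzRingType) (u : K) : sgn18_sum u =
  1 - u - u ^+ 2 - u ^+ 3 - u ^+ 4 - u ^+ 5 + u ^+ 6 + u ^+ 7 + u ^+ 8
  - u ^+ 9 + u ^+ 10 + u ^+ 11 - u ^+ 12 + u ^+ 13 - u ^+ 14 + u ^+ 15
  + u ^+ 16.
Proof. by rewrite /sgn18_sum !big_ord_recl big_ord0 /=; ring. Qed.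

(** The list of signs is symmetric up to an alternating sign: the entries at k
    and 16 - k differ by the factor (-1)^k.  (On the trace side this is the
    invariance of Tr under the Frobenius map.)  Hence reversing the polynomial
    amounts to replacing [u] by [- u]. *)
Lemma sgn18_sum_inv {K : comNzRingType} {u v : K} : u * v = 1 ->
  sgn18_sum v = v ^+ 16 * sgn18_sum (- u).
Proof.
move=> uv1; rewrite /sgn18_sum (reindex_inj rev_ord_inj) mulr_sumr.
apply: eq_bigr => k _.
have le_k16 : (k <= 16)%N by rewrite -ltnS.
have -> : (sgn18`_(rev_ord k))%:~R = (-1) ^+ k * (sgn18`_k)%:~R :> K.
  by case: k {le_k16}; do 17?[case=> [|] //=; first by move=> _; ring].
have -> : (rev_ord k : nat) = (16 - k)%N by [].
have -> : v ^+ 16 = v ^+ (16 - k) * v ^+ k by rewrite -exprD subnK.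
rewrite [in RHS]exprNn -[LHS]mulr1 -[X in _ * X](expr1n K k) -uv1 exprMn.
by ring.
Qed.

(** This is the orthogonality of the signs to their negacyclic shifts: modulo
    X^18 + 1 the product of the sign polynomial with its reversal is
    17 X^16. *)
Lemma sgn18_sum_flat {K : comNzRingType} {u v : K} :
  u ^+ 18 = -1 -> u * v = 1 -> sgn18_sum u * sgn18_sum v = 17.
Proof.
move=> u18 uv1; rewrite (sgn18_sum_inv uv1).
(* If C_t is the t-th aperiodic autocorrelation of the signs, the product has
   coefficient C_t at both X^(16 + t) and X^(16 - t).  As C_t = C_(18 - t), the
   quotient by X^18 + 1 is the sum of C_t X^(16 - t) over t > 0. *)
have prodE : sgn18_sum u * sgn18_sum (- u) = 17 * u ^+ 16 + (u ^+ 18 + 1) *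
  (u ^+ 14 - 3 * u ^+ 12 - 3 * u ^+ 10 + u ^+ 8 + u ^+ 6 - 3 * u ^+ 4
   - 3 * u ^+ 2 + 1).
  by rewrite !sgn18_sumE; ring.
by rewrite mulrCA prodE u18 addNr mul0r addr0 mulrCA -exprMn mulrC [v * u]mulrC
  uv1 expr1n mul1r.
Qed.

(** The factor ['i ^+ x] turns the negacyclic signs into a function on the
    cyclic group, because ['i ^+ 18 = -1]. *)
Definition mu18 (R : realType) : {ffun 'Z_18 -> R[i]} :=
  [ffun x : 'Z_18 => (sgn18`_x)%:~R * 'i ^+ x].

Lemma fourier_mu18 (R : realType) (chi : 'Z_18 -> R[i]) : is_character chi ->
  fourier (mu18 R) chi = sgn18_sum ((chi 1)^* * 'i).
Proof.
move=> cchi; rewrite /fourier /sgn18_sum big_ord_recr /= !ffunE /= mul0r mulr0.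
rewrite addr0; apply: eq_bigr => k _.
rewrite ffunE -[widen_ord _ k]natr_Zp is_character_mulrn // natr_Zp /=.
by rewrite rmorphXn mulrCA exprMn.
Qed.

Lemma mulc_conj (R : rcfType) (z : R[i]) : z * z^* = (normc z ^+ 2)%:C.
Proof. by rewrite -sqr_normc rmorphXn. Qed.

Lemma normc_i (R : rcfType) : normc ('i : R[i]) = 1.
Proof. by rewrite /normc /= expr0n expr1n add0r sqrtr1. Qed.

Lemma normcX (R : rcfType) (z : R[i]) n : normc (z ^+ n) = normc z ^+ n.
Proof.
by elim: n => [|n IHn]; rewrite ?expr0 ?normc1 // !exprS normcM IHn.
Qed.

(** Conjugating the sign polynomial at a point of the unit circle evaluates it
    at the inverse of that point, and all points involved are 18th roots of -1:
    an 18th root of unity times ['i]. *)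
Lemma normc_fourier_mu18 (R : realType) (chi : 'Z_18 -> R[i]) :
  is_character chi -> normc (fourier (mu18 R) chi) = Num.sqrt 17.
Proof.
move=> cchi; rewrite fourier_mu18 //; set u := _ * 'i.
have u18 : u ^+ 18 = -1.
  rewrite exprMn -rmorphXn -is_character_mulrn //.
  have -> : 1 *+ 18 = 0 :> 'Z_18 by apply/val_inj.
  by rewrite is_character0 // rmorph1 mul1r (exprM _ 2 9) sqr_i -signr_odd.
have uJ : u * u^* = 1.
  rewrite mulc_conj normcM normc_i mulr1.
  have -> : normc (chi 1)^* = 1.
    by have := complexI (normcJ (chi 1)); rewrite (proj1 cchi).
  by rewrite expr1n.
have : sgn18_sum u * (sgn18_sum u)^* = 17%:R.
  rewrite -(sgn18_sum_flat u18 uJ); congr (_ * _).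
  rewrite /sgn18_sum rmorph_sum; apply: eq_bigr => k _.
  by rewrite rmorphM rmorph_int rmorphXn.
rewrite mulc_conj -[17%:R](rmorph_nat (real_complex R)) => /complexI <-.
by rewrite sqrtr_sqr ger0_norm //; case: (sgn18_sum _) => a b;
  apply: sqrtr_ge0.
Qed.

Lemma ltn_Z18 (x : 'Z_18) : (x < 17)%N = (x != 17%R).
Proof. by rewrite ltn_neqAle -ltnS ltn_ord andbT. Qed.

Lemma normc_mu18 (R : realType) (x : 'Z_18) :
  normc (mu18 R x) = (x != 17%R)%:R.
Proof.
rewrite ffunE normcM normcX normc_i expr1n mulr1.
have [->|] := eqVneq x 17%R; first by rewrite normc0.
rewrite -ltn_Z18 => lt_x17; have := @mem_nth _ 0 sgn18 x lt_x17.
have /allP/[apply] : all (mem [:: 1; -1]) sgn18 by [].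
by rewrite !inE => /orP[]/eqP->; rewrite ?normcN normc1.
Qed.

Lemma msupp_mu18 (R : realType) : msupp (mu18 R) = [set~ 17%R]%SET.
Proof.
apply/setP=> x; rewrite !inE; apply/idP/idP.
  by apply: contraNneq => ->; rewrite ffunE mul0r.
by apply: contraNneq => m0; have := normc_mu18 R x; rewrite m0 normc0;
  case: eqP => // _ /eqP; rewrite eq_sym oner_eq0.
Qed.

Lemma mnorm_mu18 (R : realType) : mnorm (mu18 R) = 17.
Proof.
rewrite /mnorm (eq_bigr _ (fun x _ => normc_mu18 R x)) -natr_sum.
by rewrite -big_mkcond sum1dep_card cardsE cardC1 card_ord.
Qed.

Theorem proposition7p30 (R : realType) :
  extreme_set R ([set (k : nat)%:R | k : 'I_17]%SET : {set 'Z_18}).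
Proof.
have supp17 : #|msupp (mu18 R)| = 17%N by rewrite msupp_mu18 cardsC1 card_ord.
exists (mu18 R); split; first split.
- apply/eqP=> m0; have /eqP := normc_mu18 R 0.
  by rewrite m0 ffunE normc0 eq_sym oner_eq0.
- have [chi cchi [-> _]] := fourier_normP (mu18 R).
  rewrite normc_fourier_mu18 // mnorm_mu18 supp17.
  rewrite -[X in X / _]sqr_sqrtr ?ler0n //.
  by rewrite expr2 mulfK // sqrtr_eq0 -ltNge ltr0n.
rewrite msupp_mu18; apply/setP=> x; rewrite !inE; apply/idP/imsetP.
  by rewrite -ltn_Z18 => lt_x17; exists (Ordinal lt_x17); rewrite ?natr_Zp.
case=> k _ ->; rewrite -ltn_Z18 val_Zp_nat // modn_small //.
exact: ltnW (ltn_ord k).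
Qed.
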